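(* Let $(M,\varphi,g)$ be an almost Golden Riemannian manifold. The first canonical connection $\nabla^{0}$ is adapted to $(\varphi,g)$. Moreover, the set of natural (i.e. adapted) derivation laws of $(\varphi,g)$ is $$\{\nabla^{0}+Q\colon Q\in\mathcal{L},\ g(Q(X,Y),Z)+g(Q(X,Z),Y)=0,\ \forall X,Y,Z\in\mathfrak{X}(M)\}.$$
   Context: Manifolds and tensor fields are of class $C^\infty$; $\mathfrak{X}(M)$ denotes the module of vector fields on $M$. A derivation law on $M$ is the covariant derivative of a linear connection on $M$. An almost Golden structure on $M$ is a tensor field $\varphi$ of type $(1,1)$ with $\varphi^2=\varphi+Id$ (a polynomial structure of degree exactly 2, i.e. $\varphi$ and $Id$ are linearly independent). An almost Golden Riemannian manifold $(M,\varphi,g)$ is a manifold with an almost Golden structure $\varphi$ and a Riemannian metric $g$ such that $g(\varphi X,Y)=g(X,\varphi Y)$ for all $X,Y\in\mathfrak{X}(M)$. A derivation law $\nabla$ is natural or adapted to $(\varphi,g)$ if $\nabla\varphi=0$ and $\nabla g=0$. The induced almost product structure is $J_\varphi=\frac{1}{\sqrt5}(2\varphi-Id)$, which satisfies $J_\varphi^2=Id$. The first canonical connection is the linear connection with covariant derivative $\nabla^{0}_XY=\nabla^{\mathrm g}_XY-\frac12(\nabla^{\mathrm g}_XJ_\varphi)J_\varphi Y$, where $\nabla^{\mathrm g}$ is the Levi-Civita connection of $g$. $\mathcal{T}^1_2(M)$ is the module of tensor fields $Q$ on $M$ that are $C^\infty(M)$-bilinear maps $\mathfrak{X}(M)\times\mathfrak{X}(M)\to\mathfrak{X}(M)$,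 and $\mathcal{L}=\{Q\in\mathcal{T}^1_2(M)\colon Q(X,J_\varphi Y)=J_\varphi Q(X,Y),\ \forall X,Y\in\mathfrak{X}(M)\}$. $\nabla^0+Q$ denotes the derivation law $(X,Y)\mapsto\nabla^0_XY+Q(X,Y)$. *)

(* Defs.v *)
From HB Require Import structures.
From mathcomp Require Import all_boot all_order all_algebra.
From mathcomp Require Import all_classical all_reals all_analysis.
From mathcomp Require Import ring.

Set Implicit Arguments.
Unset Strict Implicit.
Unset Printing Implicit Defensive.

Import Order.TTheory GRing.Theory Num.Theory.
Import numFieldNormedType.Exports.

Local Open Scope classical_set_scope.
Local Open Scope ring_scope.

Section SmoothEuclidean.
Context {R : realType} {V W : normedModType R}.

(* [Ck k U f] is only meant for [U] open: differentiability at a point of [U]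
   is that of [f] on a full neighbourhood of the point. *)
Fixpoint Ck (k : nat) (U : set V) (f : V -> W) : Prop :=
  match k with
  | 0%N => forall x, U x -> {for x, continuous f}
  | k'.+1 => (forall x, U x -> differentiable f x) /\
             (forall v, Ck k' U (fun x => 'D_v f x))
  end.

Definition smooth_on (U : set V) (f : V -> W) : Prop := forall k, Ck k U f.

Lemma near_eq_differentiable (f f' : V -> W) (x : V) :
  {near x, f =1 f'} -> differentiable f x -> differentiable f' x.
Proof.
move=> ff' /diff_locallyP[cdf fx].
have f'x : f' \o shift x = cst (f' x) + 'd f x +o_ 0 id.
  apply/eqaddoP => e e0; move/eqaddoP: fx => /(_ e e0) fx.
  have ff'0 : \forall y \near 0, f (y + x) = f' (y + x).
    pose P := [set y | f y = f' y]; have : \near x, P x by exact: ff'.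
    by rewrite (near_shift 0) /= subr0.
  near=> y; have <- : (f \o shift x - (cst (f x) + 'd f x)) y =
                      (f' \o shift x - (cst (f' x) + 'd f x)) y.
    rewrite !fctE /= (nbhs_singleton ff'); congr (_ - _); near: y; exact: ff'0.
  by near: y.
have df' := diff_unique cdf f'x.
by apply/diff_locallyP; rewrite df'.
Unshelve. all: by end_near. Qed.

Lemma eq_Ck k U (f f' : V -> W) : open U -> (forall x, U x -> f x = f' x) ->
  Ck k U f -> Ck k U f'.
Proof.
move=> oU; elim: k f f' => [|k IHk] f f' ff' /=.
  move=> Cf x Ux; have nff' : \forall y \near x, f y = f' y.
    by near=> y; apply: ff'; near: y; exact: open_nbhs_nbhs.
  have Cfx : f @ x --> f x := Cf x Ux.
  suff : f' @ x --> f' x by [].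
  by rewrite -(ff' x Ux); apply: cvg_trans Cfx; exact: near_eq_cvg.
move=> [df Cf]; split=> [x Ux|v].
  have nff' : {near x, f =1 f'}.
    by near=> y; apply: ff'; near: y; exact: open_nbhs_nbhs.
  exact: near_eq_differentiable nff' (df x Ux).
apply: IHk (Cf v) => x Ux; apply: near_eq_derive.
by near=> y; apply: ff'; near: y; exact: open_nbhs_nbhs.
Unshelve. all: by end_near. Qed.

Lemma CkW k U (f : V -> W) : Ck k.+1 U f -> Ck k U f.
Proof.
elim: k f => [|k IHk] f [df Cf] /=.
  by move=> x Ux; exact: differentiable_continuous (df x Ux).
by split=> // v; apply: IHk; exact: Cf.
Qed.

Lemma Ck_cst k U (a : W) : Ck k U (cst a : V -> W).
Proof.
elim: k a => [|k IHk] a /=; first by move=> x _; exact: cvg_cst.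
split=> [x _|v]; first exact: differentiable_cst.
rewrite (_ : (fun x => _) = cst 0)//; apply/funext => x.
by rewrite derive_cst.
Qed.

Lemma CkB k U (f g : V -> W) : open U -> Ck k U f -> Ck k U g ->
  Ck k U (f - g).
Proof.
move=> oU; elim: k f g => [|k IHk] f g /=.
  by move=> Cf Cg x Ux; apply: continuousB; [exact: Cf|exact: Cg].
move=> [df Cf] [dg Cg]; split=> [x Ux|v].
  by apply: differentiableB; [exact: df|exact: dg].
apply: eq_Ck (IHk _ _ (Cf v) (Cg v)) => // x Ux.
by rewrite deriveB//; apply: diff_derivable; [exact: df|exact: dg].
Qed.

End SmoothEuclidean.

Lemma CkM (R : realType) (V : normedModType R) k U (f g : V -> R) : open U ->
  Ck k U f -> Ck k U g -> Ck k U (f * g).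
Proof.
move=> oU; elim: k f g => [|k IHk] f g.
  by move=> /= Cf Cg x Ux; apply: continuousM; [exact: Cf|exact: Cg].
move=> Cf1 Cg1; have [Cf0 Cg0] := (CkW Cf1, CkW Cg1).
move: Cf1 Cg1 => /= [df Cf] [dg Cg]; split=> [x Ux|v].
  by apply: differentiableM; [exact: df|exact: dg].
pose Df := (fun x => 'D_v f x) : V -> R; pose Dg := (fun x => 'D_v g x) : V -> R.
have CDf : Ck k U (0 - g * Df).
  by apply: CkB => //; [exact: Ck_cst|apply: IHk => //; exact: Cf].
apply: (@eq_Ck _ _ _ k U (f * Dg - (0 - g * Df))) => //.
  move=> x Ux; rewrite deriveM; last 2 first.
    by apply: diff_derivable; exact: df.
    by apply: diff_derivable; exact: dg.
  by rewrite opprB subr0.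
by apply: CkB => //; apply: IHk => //; exact: Cg.
Qed.

Section Charts.
Context {R : realType} {n : nat} {M : topologicalType}.

(* [chart_inv] is the inverse of [chart_fun] on [chart_img] only; outside
   [chart_dom] and [chart_img] the two functions are irrelevant. *)
Record chart := Chart {
  chart_dom : set M;
  chart_fun : M -> 'rV[R]_n;
  chart_inv : 'rV[R]_n -> M;
  chart_img := chart_fun @` chart_dom;
  chart_dom_open : open chart_dom;
  chart_img_open : open chart_img;
  chart_funK : forall p, chart_dom p -> chart_inv (chart_fun p) = p;
  chart_fun_cont : forall p, chart_dom p -> {for p, continuous chart_fun};
  chart_inv_cont : forall x, chart_img x -> {for x, continuous chart_inv}
}.

Definition transition_smooth (c c' : chart) : Prop :=
  smooth_on (chart_fun c @` (chart_dom c `&` chart_dom c'))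
            (chart_fun c' \o chart_inv c).

End Charts.
Arguments chart : clear implicits.

(* The atlas need not be maximal: the smooth functions are those of the maximal
   atlas it generates. *)
Record manifold (R : realType) (n : nat) := Manifold {
  manifold_sort :> topologicalType;
  atlas : set (chart R n manifold_sort);
  manifold_hausdorff : hausdorff_space manifold_sort;
  manifold_second_countable : @second_countable manifold_sort;
  atlas_cover : forall p, exists2 c, atlas c & chart_dom c p;
  atlas_smooth : forall c c', atlas c -> atlas c' -> transition_smooth c c'
}.

Section SmoothFunctions.
Context {R : realType} {n : nat} (M : manifold R n).

Definition smooth (f : M -> R) : Prop :=
  forall c, atlas c -> smooth_on (chart_img c) (f \o chart_inv c).

Definition smoothb : {pred M -> R} := [pred f | `[< smooth f >]].

Lemma smooth_subring_closed : subring_closed smoothb.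
Proof.
split=> [|f g /asboolP sf /asboolP sg|f g /asboolP sf /asboolP sg].
- by apply/asboolP => c _ k; exact: Ck_cst.
- apply/asboolP => c ac k.
  by apply: CkB (sf c ac k) (sg c ac k); exact: chart_img_open.
- apply/asboolP => c ac k.
  by apply: CkM (sf c ac k) (sg c ac k); exact: chart_img_open.
Qed.

Record Cinf := MkCinf { Cinf_fun :> M -> R; _ : Cinf_fun \in smoothb }.

HB.instance Definition _ := [isSub for Cinf_fun].
HB.instance Definition _ := [Choice of Cinf by <:].
HB.instance Definition _ := 
  GRing.SubChoice_isSubComPzRing.Build _ _ Cinf smooth_subring_closed.

Lemma Cinf_smooth (f : Cinf) : smooth f.
Proof. by case: f => f /= /asboolP. Qed.

Lemma CinfDE (f f' : Cinf) p : (f + f') p = f p + f' p. Proof. by []. Qed.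
Lemma CinfNE (f : Cinf) p : (- f) p = - f p. Proof. by []. Qed.
Lemma CinfME (f f' : Cinf) p : (f * f') p = f p * f' p. Proof. by []. Qed.
Lemma Cinf0E p : (0 : Cinf) p = 0. Proof. by []. Qed.
Lemma Cinf1E p : (1 : Cinf) p = 1. Proof. by []. Qed.

Lemma Cinf_cst_subproof (a : R) : (cst a : M -> R) \in smoothb.
Proof. by apply/asboolP => c _ k; exact: Ck_cst. Qed.

Definition Cinf_cst (a : R) : Cinf := MkCinf (Cinf_cst_subproof a).

End SmoothFunctions.

Section VectorFields.
Context {R : realType} {n : nat} (M : manifold R n).

(* The tangent space at [p]: point derivations of the algebra of smooth
   functions. *)
Definition tangent (p : M) : set (Cinf M -> R) := [set v |
  (forall (a : R) (f f' : Cinf M), v (Cinf_cst M a * f + f') = a * v f + v f') /\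
  (forall f f' : Cinf M, v (f * f') = f p * v f' + f' p * v f)].

Definition vfield_pred (X : M -> Cinf M -> R) : Prop :=
  (forall p, tangent p (X p)) /\ (forall f, smooth (X ^~ f)).

Definition vfieldb : {pred M -> Cinf M -> R} :=
  [pred X | `[< vfield_pred X >]].

Lemma vfield_zmod_closed : zmod_closed vfieldb.
Proof.
split=> [|X Y /asboolP[tX sX] /asboolP[tY sY]]; apply/asboolP; split.
- move=> p; split=> [a f f'|f f'].
    by rewrite [RHS](_ : _ = a * 0 + 0) ?mulr0 ?addr0.
  by rewrite [RHS](_ : _ = f p * 0 + f' p * 0) ?mulr0 ?addr0.
- by move=> f c _ k; exact: Ck_cst.
- have BE p f : (X - Y) p f = X p f - Y p f by [].
  move=> p; split=> [a f f'|f f']; rewrite !BE.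
    by rewrite (tX p).1 (tY p).1; ring.
  by rewrite (tX p).2 (tY p).2; ring.
- move=> f c ac k.
  by apply: CkB (sX f c ac k) (sY f c ac k); exact: chart_img_open.
Qed.

(* [X p f] is the derivative of [f] at [p] in the direction of [X]. *)
Record vfield := MkVfield {
  vfield_fun :> M -> Cinf M -> R; _ : vfield_fun \in vfieldb }.

HB.instance Definition _ := [isSub for vfield_fun].
HB.instance Definition _ := [Choice of vfield by <:].
HB.instance Definition _ :=
  GRing.SubChoice_isSubZmodule.Build _ _ vfield vfield_zmod_closed.

Lemma vfieldP (X : vfield) : vfield_pred X.
Proof. by case: X => X /= /asboolP. Qed.

Lemma vfield_eqP (X Y : vfield) : X = Y <-> forall p f, X p f = Y p f.
Proof.
split=> [->//|XY]; apply/val_inj/funext => p; apply/funext => f; exact: XY.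
Qed.

Lemma vfieldDE (X Y : vfield) p f : (X + Y) p f = X p f + Y p f.
Proof. by []. Qed.
Lemma vfieldNE (X : vfield) p f : (- X) p f = - X p f. Proof. by []. Qed.
Lemma vfield0E p f : (0 : vfield) p f = 0. Proof. by []. Qed.

Lemma vfield_scale_subproof (h : Cinf M) (X : vfield) :
  (fun p f => h p * X p f) \in vfieldb.
Proof.
have [tX sX] := vfieldP X; apply/asboolP; split.
  move=> p; split=> [a f f'|f f']; rewrite ?((tX p).1) ?((tX p).2); ring.
move=> f c ac k.
by apply: CkM (@Cinf_smooth _ _ _ h c ac k) (sX f c ac k); exact: chart_img_open.
Qed.

Definition vfield_scale (h : Cinf M) (X : vfield) : vfield :=
  MkVfield (vfield_scale_subproof h X).

Lemma vfield_scaleA (h h' : Cinf M) (X : vfield) :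
  vfield_scale h (vfield_scale h' X) = vfield_scale (h * h') X.
Proof. by apply/vfield_eqP => p f /=; rewrite mulrA. Qed.

Lemma vfield_scale1 : left_id 1 vfield_scale.
Proof. by move=> X; apply/vfield_eqP => p f /=; rewrite mul1r. Qed.

Lemma vfield_scaleDr : right_distributive vfield_scale +%R.
Proof. by move=> h X Y; apply/vfield_eqP => p f /=; rewrite !fctE mulrDr. Qed.

Lemma vfield_scaleDl X : {morph vfield_scale^~ X : h h' / h + h'}.
Proof. by move=> h h'; apply/vfield_eqP => p f /=; rewrite !fctE mulrDl. Qed.

HB.instance Definition _ := GRing.Zmodule_isLmodule.Build (Cinf M) vfield
  vfield_scaleA vfield_scale1 vfield_scaleDr vfield_scaleDl.

Lemma vfieldZE (h : Cinf M) (X : vfield) p f : (h *: X) p f = h p * X p f.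
Proof. by []. Qed.

Lemma vact_subproof (X : vfield) (f : Cinf M) :
  (fun p => X p f) \in @smoothb _ _ M.
Proof. by apply/asboolP; exact: (vfieldP X).2. Qed.

Definition vact (X : vfield) (f : Cinf M) : Cinf M :=
  MkCinf (vact_subproof X f).

Lemma bracket_subproof (X Y : vfield) :
  (fun p f => X p (vact Y f) - Y p (vact X f)) \in vfieldb.
Proof.
have [[tX sX] [tY sY]] := (vfieldP X, vfieldP Y).
have lin (Z : vfield) a f f' :
    vact Z (Cinf_cst M a * f + f') = Cinf_cst M a * vact Z f + vact Z f'.
  by apply/val_inj/funext => p; exact: ((vfieldP Z).1 p).1.
have leib (Z : vfield) f f' : vact Z (f * f') = f * vact Z f' + f' * vact Z f.
  by apply/val_inj/funext => p; exact: ((vfieldP Z).1 p).2.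
have add (Z : vfield) p f f' : Z p (f + f') = Z p f + Z p f'.
  have := ((vfieldP Z).1 p).1 1 f f'; rewrite mul1r => <-.
  by rewrite (_ : Cinf_cst M 1 = 1) ?mul1r//; exact: val_inj.
apply/asboolP; split.
  move=> p; split=> [a f f'|f f'].
    by rewrite !lin (tX p).1 (tY p).1; ring.
  by rewrite !leib !add !(tX p).2 !(tY p).2 /=; ring.
move=> f c ac k; apply: CkB; first exact: chart_img_open.
  exact: (sX (vact Y f)).
exact: (sY (vact X f)).
Qed.

Definition bracket (X Y : vfield) : vfield := MkVfield (bracket_subproof X Y).

End VectorFields.

Section Tensors.
Context {R : realType} {n : nat} {M : manifold R n}.
Implicit Types (X Y Z : vfield M) (D Q : vfield M -> vfield M -> vfield M).

Definition tensor12 Q : Prop :=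
  (forall Y, linear (Q^~ Y)) /\ (forall X, linear (Q X)).

(* Positivity is pointwise: at every point where [X] does not vanish. *)
Record riemannian_metric (g : vfield M -> vfield M -> Cinf M) : Prop := {
  metric_linearl : forall Y, scalar (g^~ Y);
  metric_linearr : forall X, scalar (g X);
  metric_sym : forall X Y, g X Y = g Y X;
  metric_pos : forall X p, X p <> (fun _ => 0) -> 0 < g X X p
}.

Record derivation_law D : Prop := {
  derivation_law_linear : forall Y, linear (D^~ Y);
  derivation_law_additive : forall X Y Z, D X (Y + Z) = D X Y + D X Z;
  derivation_law_leibniz : forall X (f : Cinf M) Y,
    D X (f *: Y) = vact X f *: Y + f *: D X Y
}.

(* [cov_endo D F X Y] is (D_X F)(Y). *)
Definition cov_endo D (F : vfield M -> vfield M) X Y : vfield M :=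
  D X (F Y) - F (D X Y).

(* [cov_metric D g X Y Z] is (D_X g)(Y, Z). *)
Definition cov_metric D (g : vfield M -> vfield M -> Cinf M) X Y Z : Cinf M :=
  vact X (g Y Z) - g (D X Y) Z - g Y (D X Z).

Definition levi_civita (g : vfield M -> vfield M -> Cinf M) D : Prop :=
  [/\ derivation_law D,
      forall X Y Z, cov_metric D g X Y Z = 0 &
      forall X Y, D X Y - D Y X = bracket X Y].

(* Tensor fields of type (1,1) are the endomorphisms of the module of vector
   fields over the ring of smooth functions. [phi] and the identity are
   independent over the reals: the scalars are constant functions. *)
Definition almost_golden (phi : {linear vfield M -> vfield M}) : Prop :=
  (forall X, phi (phi X) = phi X + X) /\
  (forall a b : R,
     (forall X, Cinf_cst M a *: phi X + Cinf_cst M b *: X = 0) ->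
     a = 0 /\ b = 0).

Definition almost_golden_riemannian (phi : {linear vfield M -> vfield M})
    (g : vfield M -> vfield M -> Cinf M) : Prop :=
  [/\ almost_golden phi, riemannian_metric g &
      forall X Y, g (phi X) Y = g X (phi Y)].

Definition natural_law (phi : {linear vfield M -> vfield M})
    (g : vfield M -> vfield M -> Cinf M) D : Prop :=
  [/\ derivation_law D,
      forall X Y, cov_endo D phi X Y = 0 &
      forall X Y Z, cov_metric D g X Y Z = 0].

Definition Jgolden (phi : {linear vfield M -> vfield M}) X : vfield M :=
  Cinf_cst M (Num.sqrt 5)^-1 *: (Cinf_cst M 2 *: phi X - X).

(* The first canonical connection, [D] being the Levi-Civita connection. *)
Definition nabla0 (phi : {linear vfield M -> vfield M}) D X Y : vfield M :=
  D X Y - Cinf_cst M 2^-1 *: cov_endo D (Jgolden phi) X (Jgolden phi Y).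

Definition calL (phi : {linear vfield M -> vfield M}) :
    set (vfield M -> vfield M -> vfield M) :=
  [set Q | tensor12 Q /\
           forall X Y, Q X (Jgolden phi Y) = Jgolden phi (Q X Y)].

End Tensors.

(* Main.v *)
From HB Require Import structures.
Require Import Defs.
From mathcomp Require Import all_boot all_order all_algebra.
From mathcomp Require Import all_classical all_reals all_analysis.
From mathcomp Require Import ring.

(** Write [J] for the almost product structure of [phi]. As [J] is an affine
    function of [phi] with constant coefficients and nonzero slope, and
    constants are parallel for every derivation law, [phi] and [J] have the
    same parallelizing laws ([Jgolden_parallel]); so [phi] can be replaced by
    the involution [J], which is self-adjoint for [g], hence an isometry.

    Since [J] squares to the identity, the first canonical connection is the
    average of the Levi-Civita law [D] and its conjugate
    [fun X Y => J (D X (J Y))] ([product_averageE]). Conjugation by [J] sends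
    laws to laws and, [J] being an isometry, metric laws to metric laws; an
    average of metric laws is again metric. Conjugation by the involution [J]
    swaps the two summands, so their average commutes with [J]. This shows
    that the first canonical connection is adapted.

    The derivation laws form an affine space directed by the tensor fields of
    type (1,2) ([tensor_of_laws], [derivation_lawD_tensor]). Adding a tensor
    [Q] to an adapted law changes the covariant derivative of [J] by the
    commutator of [Q X] and [J], and that of [g] by minus
    [g (Q X Y) Z + g (Q X Z) Y] ([cov_endoD_tensor], [cov_metricD_tensor]);
    the sum is adapted exactly when both changes vanish. *)

Import Order.TTheory GRing.Theory Num.Theory.

Local Open Scope classical_set_scope.
Local Open Scope ring_scope.

(** * Derivation laws as an affine space over the (1,2) tensor fields *)

Section Laws.
Context {R : realType} {n : nat} {M : manifold R n}.
Local Notation VF := (vfield M).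
Local Notation cst := (@Cinf_cst R n M).
Implicit Types (X Y Z : VF) (D Q : VF -> VF -> VF).
Implicit Types (g : VF -> VF -> Cinf M).

Lemma vfield_cst1 X : cst 1 *: X = X.
Proof. by apply/vfield_eqP => p f; rewrite vfieldZE /= mul1r. Qed.

Lemma vfield_cstZ (a b : R) X : cst a *: (cst b *: X) = cst (a * b) *: X.
Proof. by apply/vfield_eqP => p f; rewrite !vfieldZE /= mulrA. Qed.

(** Point derivations are linear over the reals and kill 1 by the Leibniz rule,
    hence kill every constant. *)
Lemma vact_cst X (a : R) : vact X (cst a) = 0.
Proof.
have [tX _] := vfieldP X; apply/val_inj/funext => p /=.
have X1 : X p 1 = 0.
  (* The Leibniz rule for 1 * 1 reads v = v + v. *)
  have := (tX p).2 1 1; rewrite mulr1 Cinf1E mul1r => /eqP.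
  by rewrite -subr_eq subrr => /eqP.
have X0 : X p 0 = 0.
  by have := (tX p).2 0 0; rewrite mulr0 Cinf0E mul0r addr0.
by have := (tX p).1 a 1 0; rewrite mulr1 addr0 X1 X0 mulr0 addr0.
Qed.

Lemma derivation_law_cstZ D : derivation_law D ->
  forall X (a : R) Y, D X (cst a *: Y) = cst a *: D X Y.
Proof. by move=> [_ _ DL] X a Y; rewrite DL vact_cst scale0r add0r. Qed.

(** The derivative terms of the two Leibniz rules cancel in the difference. *)
Lemma tensor_of_laws D D' :
  derivation_law D -> derivation_law D' -> tensor12 (D' - D).
Proof.
move=> [Dl DD DL] [Dl' DD' DL'].
split=> [Y a X X'|X a Y Y']; rewrite !fctE.
  by rewrite Dl Dl'; apply/vfield_eqP => p f;
     rewrite !(vfieldDE, vfieldNE, vfieldZE); ring.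
by rewrite DD DD' DL DL'; apply/vfield_eqP => p f;
   rewrite !(vfieldDE, vfieldNE, vfieldZE); ring.
Qed.

Lemma derivation_lawD_tensor D Q :
  derivation_law D -> tensor12 Q -> derivation_law (D + Q).
Proof.
move=> [Dl DD DL] [Ql Qr].
have QD X Y Y' : Q X (Y + Y') = Q X Y + Q X Y'.
  by have := Qr X 1 Y Y'; rewrite !scale1r.
have QZ X (h : Cinf M) Y : Q X (h *: Y) = h *: Q X Y.
  have Q0 : Q X 0 = 0 by apply: (addrI (Q X 0)); rewrite -QD !addr0.
  by have := Qr X h Y 0; rewrite !addr0 Q0 addr0.
split=> [Y a X X'|X Y Z|X h Y]; rewrite !fctE.
- by rewrite Dl Ql scalerDr addrACA.
- by rewrite DD QD addrACA.
- by rewrite DL QZ scalerDr addrA.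
Qed.

Lemma cov_endoD_tensor D Q (F : {linear VF -> VF}) X Y :
  cov_endo (D + Q) F X Y = cov_endo D F X Y + (Q X (F Y) - F (Q X Y)).
Proof. by rewrite /cov_endo !fctE linearD opprD addrACA. Qed.

(** The identity is parallel for every law, so only the slope of an affine
    function of [F] is seen by the covariant derivative. *)
Lemma cov_endo_affine D (F G : {linear VF -> VF}) (a b : R) :
  derivation_law D -> (forall Y, G Y = cst a *: F Y + cst b *: Y) ->
  forall X Y, cov_endo D G X Y = cst a *: cov_endo D F X Y.
Proof.
move=> lD GE X Y; have [_ DD _] := lD.
rewrite /cov_endo !GE DD !(derivation_law_cstZ _ lD) scalerBr.
by rewrite opprD addrACA subrr addr0.
Qed.

Lemma cov_endo_affine_eq0 D (F G : {linear VF -> VF}) (a b : R) :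
  derivation_law D -> a != 0 -> (forall Y, G Y = cst a *: F Y + cst b *: Y) ->
  (forall X Y, cov_endo D G X Y = 0) <-> (forall X Y, cov_endo D F X Y = 0).
Proof.
move=> lD a0 GE; split=> H X Y.
  rewrite -[LHS]vfield_cst1 -(mulVf a0) -vfield_cstZ.
  by rewrite -(cov_endo_affine _ _ _ _ _ lD GE) H scaler0.
by rewrite (cov_endo_affine _ _ _ _ _ lD GE) H scaler0.
Qed.

Section Metric.
Context {g : VF -> VF -> Cinf M} (rg : riemannian_metric g).

Lemma metricDl X Y Z : g (X + Y) Z = g X Z + g Y Z.
Proof.
by have := metric_linearl rg Z 1 X Y; rewrite scale1r => ->; congr (_ + _);
   exact: mul1r.
Qed.

Lemma metricZl (h : Cinf M) X Z : g (h *: X) Z = h * g X Z.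
Proof.
have g0 : g 0 Z = 0 by apply: (addrI (g 0 Z)); rewrite -metricDl !addr0.
by have := metric_linearl rg Z h X 0; rewrite !addr0 g0 addr0.
Qed.

Lemma metricDr X Y Z : g Z (X + Y) = g Z X + g Z Y.
Proof. by rewrite !(Defs.metric_sym rg Z) metricDl. Qed.

Lemma metricZr (h : Cinf M) X Z : g Z (h *: X) = h * g Z X.
Proof. by rewrite !(Defs.metric_sym rg Z) metricZl. Qed.

Lemma cov_metricD_tensor D Q X Y Z :
  cov_metric (D + Q) g X Y Z =
  cov_metric D g X Y Z - (g (Q X Y) Z + g (Q X Z) Y).
Proof.
rewrite /cov_metric !fctE metricDl metricDr (Defs.metric_sym rg Y (Q X Z)).
by apply/val_inj/funext => p; rewrite /= !fctE; ring.
Qed.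

End Metric.

(** * The projection onto the laws preserving an almost product structure *)

Section AlmostProduct.
Context (J : {linear VF -> VF}) (JJ : forall X, J (J X) = X).

(** The average of [D] and of its conjugate by [J]; it projects the derivation
    laws onto those for which [J] is parallel. *)
Definition product_average D X Y : VF :=
  cst 2^-1 *: (D X Y + J (D X (J Y))).

(** With [J (J Y) = Y], the correction term is half the difference of [D] and
    its conjugate by [J]. *)
Lemma product_averageE D X Y :
  D X Y - cst 2^-1 *: cov_endo D J X (J Y) = product_average D X Y.
Proof.
rewrite /product_average /cov_endo JJ; apply/vfield_eqP => p f.
by rewrite !(vfieldDE, vfieldNE, vfieldZE) /=; field.
Qed.

(** Two applications of [J] give back the argument in the derivative term of
    the conjugate law, so that both halves obey the Leibniz rule. *)
Lemma product_average_law D :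
  derivation_law D -> derivation_law (product_average D).
Proof.
move=> [Dl DD DL]; split=> [Y a X X'|X Y Z|X h Y]; rewrite /product_average.
- rewrite !Dl (linearP J); apply/vfield_eqP => p f.
  by rewrite !(vfieldDE, vfieldZE); ring.
- by rewrite (linearD J) !DD (linearD J) addrACA scalerDr.
- rewrite (linearZZ J) !DL (linearD J) !(linearZZ J) JJ; apply/vfield_eqP => p f.
  by rewrite !(vfieldDE, vfieldZE) /=; field.
Qed.

(** Replacing [Y] by [J Y] turns each of the two averaged terms into [J] of the
    other one. *)
Lemma product_average_parallel D X Y : cov_endo (product_average D) J X Y = 0.
Proof.
by rewrite /cov_endo /product_average (linearZZ J) (linearD J) !JJ
  (addrC (D X (J Y))) subrr.
Qed.

(** [J] is an isometry, so the derivative of [g Y Z = g (J Y) (J Z)] along [X]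
    can be expanded in two ways; half the sum of both expansions is the
    metric identity for the average. *)
Lemma product_average_metric g D : riemannian_metric g ->
  (forall X Y, g (J X) Y = g X (J Y)) ->
  (forall X Y Z, cov_metric D g X Y Z = 0) ->
  forall X Y Z, cov_metric (product_average D) g X Y Z = 0.
Proof.
move=> rg gJ Dg X Y Z.
have DgE A B : vact X (g A B) = g (D X A) B + g A (D X B).
  by apply/eqP; rewrite -subr_eq0 opprD addrA; apply/eqP; exact: Dg.
have gJJ : g (J Y) (J Z) = g Y Z by rewrite gJ JJ.
have := DgE (J Y) (J Z); rewrite gJJ => E2; have E1 := DgE Y Z.
rewrite /cov_metric /product_average (metricZl rg) (metricZr rg).
(* Self-adjointness moves the outer [J] of the conjugate terms to the other
   argument of [g], as in the expansion E2. *)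
rewrite (metricDl rg) (metricDr rg) gJ -(gJ Y).
apply/val_inj/funext => p; rewrite /= !fctE /=.
have := congr1 (fun h : Cinf M => h p) E1.
have := congr1 (fun h : Cinf M => h p) E2.
rewrite /= !fctE /= => e2 e1.
rewrite -[X p _](_ : 2^-1 * (X p (g Y Z) + X p (g Y Z)) = _); last by field.
by rewrite {1}e1 e2; transitivity (0 : R); first by field.
Qed.

End AlmostProduct.

(** * The almost product structure of an almost Golden structure *)

Section Golden.
Context (phi : {linear VF -> VF}).

Lemma Jgolden_linear : linear (Jgolden phi).
Proof.
move=> a X Y; rewrite /Jgolden (linearP phi); apply/vfield_eqP => p f.
by rewrite !(vfieldDE, vfieldNE, vfieldZE); ring.
Qed.

HB.instance Definition _ :=
  GRing.isLinear.Build (Cinf M) VF VF *:%R (Jgolden phi) Jgolden_linear.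

Lemma JgoldenE X : Jgolden phi X =
  cst ((Num.sqrt 5)^-1 * 2) *: phi X + cst (- (Num.sqrt 5)^-1) *: X.
Proof.
by apply/vfield_eqP => p f; rewrite !(vfieldDE, vfieldNE, vfieldZE) /=; ring.
Qed.

(** [2 *: phi - id] has square [4 phi^2 - 4 phi + id], which is five times the
    identity when [phi^2 = phi + id]. *)
Lemma Jgolden_involutive :
  (forall X, phi (phi X) = phi X + X) -> involutive (Jgolden phi).
Proof.
move=> phi2 X; rewrite /Jgolden (linearZZ phi) (linearB phi) (linearZZ phi) phi2.
apply/vfield_eqP => p f; rewrite !(vfieldDE, vfieldNE, vfieldZE) /=.
have s5 : Num.sqrt 5 ^+ 2 = 5 :> R by rewrite sqr_sqrtr.
have s0 : Num.sqrt 5 != 0 :> R by rewrite sqrtr_eq0 -ltNge ltr0n.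
by field: s5.
Qed.

Lemma Jgolden_selfadjoint g : riemannian_metric g ->
  (forall X Y, g (phi X) Y = g X (phi Y)) ->
  forall X Y, g (Jgolden phi X) Y = g X (Jgolden phi Y).
Proof.
move=> rg gphi X Y; rewrite !JgoldenE.
by rewrite (metricDl rg) (metricDr rg) !(metricZl rg) !(metricZr rg) gphi.
Qed.

(** Reduces adaptedness to [phi] to adaptedness to the involution [J]. *)
Lemma Jgolden_parallel D : derivation_law D ->
  (forall X Y, cov_endo D (Jgolden phi) X Y = 0) <->
  (forall X Y, cov_endo D phi X Y = 0).
Proof.
move=> lD; apply: cov_endo_affine_eq0 lD _ JgoldenE.
by rewrite mulf_neq0 ?invr_eq0 ?sqrtr_eq0 -?ltNge ?ltr0n ?pnatr_eq0.
Qed.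

End Golden.

End Laws.

Theorem lemma4p4 (R : realType) (n : nat) (M : manifold R n)
    (phi : {linear vfield M -> vfield M})
    (g : vfield M -> vfield M -> Cinf M)
    (nablag : vfield M -> vfield M -> vfield M)
    (phi_g : almost_golden_riemannian phi g)
    (nablag_LC : levi_civita g nablag) :
  natural_law phi g (nabla0 phi nablag) /\
  [set D | natural_law phi g D] =
    [set nabla0 phi nablag + Q |
       Q in [set Q | calL phi Q /\
                     forall X Y Z, g (Q X Y) Z + g (Q X Z) Y = 0]].
Proof.
have [[phi2 _] rg gphi] := phi_g; have [lD Dg _] := nablag_LC.
have JJ := Jgolden_involutive _ phi2.
have gJ := Jgolden_selfadjoint _ _ rg gphi.
have nabla0E : nabla0 phi nablag = product_average (Jgolden phi) nablag.
  by apply/funext => X; apply/funext => Y; exact: product_averageE.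
set D0 := nabla0 phi nablag.
have lD0 : derivation_law D0 by rewrite /D0 nabla0E; exact: product_average_law.
have JD0 X Y : cov_endo D0 (Jgolden phi) X Y = 0.
  by rewrite /D0 nabla0E; exact: product_average_parallel.
have gD0 X Y Z : cov_metric D0 g X Y Z = 0.
  by rewrite /D0 nabla0E; exact: product_average_metric.
split; first by split=> //; exact/Jgolden_parallel.
have naturalE Q : tensor12 Q -> natural_law phi g (D0 + Q) <->
    (calL phi Q /\ forall X Y Z, g (Q X Y) Z + g (Q X Z) Y = 0).
  move=> tQ; have lDQ := derivation_lawD_tensor _ _ lD0 tQ.
  have JDQ X Y : cov_endo (D0 + Q) (Jgolden phi) X Y =
      Q X (Jgolden phi Y) - Jgolden phi (Q X Y).
    by rewrite cov_endoD_tensor JD0 add0r.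
  have gDQ X Y Z : cov_metric (D0 + Q) g X Y Z =
      - (g (Q X Y) Z + g (Q X Z) Y).
    by rewrite (cov_metricD_tensor rg) gD0 sub0r.
  split=> [[_ /(Jgolden_parallel _ _ lDQ) JQ gQ]|[[_ JQ] gQ]].
    split=> [|X Y Z]; last by apply: oppr_inj; rewrite oppr0 -gDQ gQ.
    by split=> // X Y; apply: subr0_eq; rewrite -JDQ JQ.
  split=> [//||X Y Z]; last by rewrite gDQ gQ oppr0.
  by apply/(Jgolden_parallel _ _ lDQ) => X Y; rewrite JDQ JQ subrr.
apply/seteqP; split=> [D nD|_ [Q [LQ gQ] <-]]; last first.
  by apply/naturalE; [exact: LQ.1|].
have DE : D0 + (D - D0) = D by rewrite addrC subrK.
exists (D - D0) => //; apply/naturalE; last by rewrite DE.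
by case: nD => lD' _ _; exact: tensor_of_laws.
Qed.
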